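(* Let $Q:\mathbb{R}^d\to[0,1]^N$ be the deterministic map that returns the per-qubit $S$-shot marginal vector of a parameterised quantum circuit (PQC) on $N$ qubits as a function of its $d$ real control parameters, and suppose $Q\in C^1$ on an open set $\mathcal{U}\subset\mathbb{R}^d$. Fix a mini-batch $\mathcal{B}=\{x_i\}_{i=1}^{N_b}\subset\mathcal{U}$ lying in a closed ball of radius $r$ centered at $\bar x=\frac{1}{N_b}\sum_{i}x_i$. Then for every pair of tolerances $\varepsilon_1>0$, $\varepsilon_2>0$ there exists a feed-forward MLP $Q_\theta:\mathbb{R}^d\to\mathbb{R}^N$ such that $$\max_{x\in\mathcal{B}}\bigl\|Q_\theta(x)-Q(x)\bigr\|\le\varepsilon_1,\qquad \max_{x\in\mathcal{B}}\bigl\|\nabla Q_\theta(x)-\nabla Q(x)\bigr\|\le\varepsilon_2 .$$ Consequently, if the PQC is replaced by $Q_\theta$ inside the computation graph during back-propagation, the mini-batch gradient with respect to any upstream parameter vector $w$ is perturbed by at most an additive $O\bigl(\max(\varepsilon_1,\varepsilon_2)\bigr)$ term.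
   Context: Per-qubit $S$-shot marginal vector: for a given control vector, the circuit is run for $S$ shots, each shot giving a measured bit-string in $\{0,1\}^N$; the $\ell$-th entry of the vector is the fraction of the $S$ shots in which qubit $\ell$ is measured as 1. In the theorem this is treated as a deterministic map $Q$ of the control vector. No assumption is made on the depth, connectivity or gate layout of the circuit. Feed-forward MLP: a fully connected neural network $\mathbb{R}^d\to\mathbb{R}^N$, i.e. a finite composition of affine maps alternating with a nonlinear activation function applied componentwise; $\theta$ denotes its weights and biases. The statement does not specify the activation, depth or widths. $\nabla F(x)$ denotes the Jacobian of a map $F$ at $x$. $\|\cdot\|$ denotes a norm on the finite-dimensional spaces of vectors and matrices concerned (the statement does not specify which). Computation graph: a hybrid network in which a classical neural network (upstream, with parameters such as $w$) produces from each data sample a control vector $x_i$ of the PQC; the PQC layer $Q$ maps $x_i$ to $Q(x_i)$; and a second classical network (downstream), which may also receive direct classical links from the upstream network bypassing the PQC, maps the result to a prediction entering a scalar loss. The mini-batch gradient with respect to $w$ is the gradient with respect to $w$ of the loss averaged over the $N_b$ samples of the mini-batch. Replacing the PQC by $Q_\theta$ means computing this gradient by back-propagation through the otherwise identical network in which the layer $Q$ is replaced by $Q_\theta$; the perturbation is the difference between the gradient so obtained and the one for the layer $Q$.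
   Formalization: The gradient bound additionally assumes that the upstream network and bypass links are differentiable at w and that the loss after the downstream network has a Lipschitz gradient near the batch outputs; O(·) is read for small tolerances. Without this the bound fails, e.g. for loss |y−1/2|^{3/2}. *)

(* Defs.v *)
From HB Require Import structures.
From mathcomp Require Import all_boot all_order all_algebra.
From mathcomp Require Import all_classical all_reals all_analysis.

Set Implicit Arguments.
Unset Strict Implicit.
Unset Printing Implicit Defensive.

Import Order.TTheory GRing.Theory Num.Theory.
Import numFieldNormedType.Exports.

Local Open Scope classical_set_scope.
Local Open Scope ring_scope.

Definition is_norm (R : realType) (V : lmodType R) (nu : V -> R) : Prop :=
  [/\ forall u v, nu (u + v) <= nu u + nu v,
      forall a v, nu (a *: v) = `|a| * nu v &
      forall v, nu v = 0 -> v = 0].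

(* Vectors are rows, so that ['J Q x] is the transpose of the usual Jacobian
   matrix: its (i, j) entry is the derivative of the j-th component of Q along
   the i-th coordinate. *)
Definition C1_on (R : realType) (d N : nat) (Q : 'rV[R]_d -> 'rV[R]_N)
    (U : set 'rV[R]_d) : Prop :=
  forall x, U x -> differentiable Q x /\ {for x, continuous (jacobian Q)}.

Definition gradient (R : realType) (n : nat) (f : 'rV[R]_n -> R)
    (a : 'rV[R]_n) : 'rV[R]_n :=
  \row_j 'D_(delta_mx 0 j) f a.

(* f is differentiable with Lipschitz gradient near a; this holds in particular
   when f is C^2 near a. *)
Definition C11_at (R : realType) (n : nat) (f : 'rV[R]_n -> R)
    (a : 'rV[R]_n) : Prop :=
  exists V : set 'rV[R]_n,
    [/\ nbhs a V, forall v, V v -> differentiable f v &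
        [lipschitz (gradient f v) | v in V]].

(* The marginal vector of S recorded bit-strings. A map sending a control
   vector to such a marginal takes its values in the unit cube whatever the
   circuit and the outcomes are. *)
Definition shot_marginal (R : realType) (S N : nat)
    (bits : 'I_S -> N.-tuple bool) : 'rV[R]_N :=
  \row_l (#|[set s | tnth (bits s) l]%SET|%:R / S%:R).

Definition in_unit_cube (R : realType) (N : nat) (y : 'rV[R]_N) : Prop :=
  forall l, 0 <= y 0 l <= 1.

Lemma shot_marginal_in_unit_cube (R : realType) (S N : nat)
    (bits : 'I_S -> N.-tuple bool) : in_unit_cube (shot_marginal R bits).
Proof.
move=> l; rewrite mxE divr_ge0 ?ler0n //=.
have [S0|S_gt0] := posnP S; first by rewrite [in X in _ / X]S0 invr0 mulr0.
rewrite ler_pdivrMr ?ltr0n // mul1r ler_nat.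
by rewrite (leq_trans (max_card _)) // card_ord.
Qed.

(* [mlp R m n]: fully connected networks from R^n to R^m (weights and biases).
   The activation is applied after every affine map but the last one. *)
Inductive mlp (R : realType) (m : nat) : nat -> Type :=
| OutputLayer n of 'M[R]_(n, m) & 'rV[R]_m : mlp R m n
| HiddenLayer n k of 'M[R]_(n, k) & 'rV[R]_k & mlp R m k : mlp R m n.

Fixpoint mlp_eval (R : realType) (sigma : R -> R) (m n : nat)
    (net : mlp R m n) : 'rV[R]_n -> 'rV[R]_m :=
  match net in mlp _ _ n return 'rV[R]_n -> 'rV[R]_m with
  | OutputLayer _ W b => fun x => x *m W + b
  | HiddenLayer _ _ W b net' =>
      fun x => mlp_eval sigma net' (map_mx sigma (x *m W + b))
  end.

(* The weakest regularity under which the Jacobian of every network is a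
   continuous function everywhere. *)
Definition C1_activation (R : realType) (sigma : R -> R) : Prop :=
  (forall t, derivable sigma t 1) /\ continuous (sigma^`())%classic.

Definition nonlinear_activation (R : realType) (sigma : R -> R) : Prop :=
  ~ exists a b : R, forall t, sigma t = a * t + b.

Definition mean (R : realType) (d n : nat) (x : 'I_n -> 'rV[R]_d) : 'rV[R]_d :=
  n%:R^-1 *: \sum_i x i.

Definition approx_on_batch (R : realType) (d N n : nat)
    (nuN : 'rV[R]_N -> R) (nuJ : 'M[R]_(d, N) -> R)
    (Q1 Q2 : 'rV[R]_d -> 'rV[R]_N) (x : 'I_n -> 'rV[R]_d) (e1 e2 : R) : Prop :=
  \big[Num.max/0]_(i < n) nuN (Q1 (x i) - Q2 (x i)) <= e1 /\
  \big[Num.max/0]_(i < n) nuJ (jacobian Q1 (x i) - jacobian Q2 (x i)) <= e2.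

(* The classical parts of the network, for samples of type X (labels included).
   Only the dependence on the upstream parameters w : 'rV_p under consideration
   is displayed; all the other parameters are frozen in the fields. [bypass]
   collects the classical links that do not go through the quantum layer. *)
Record hybrid_graph (R : realType) (X : Type) (p d N m k : nat) := HybridGraph {
  upstream : X -> 'rV[R]_p -> 'rV[R]_d;
  bypass : X -> 'rV[R]_p -> 'rV[R]_m;
  downstream : 'rV[R]_(N + m) -> 'rV[R]_k;
  loss : X -> 'rV[R]_k -> R
}.

Definition head_loss (R : realType) (X : Type) (p d N m k : nat)
    (G : hybrid_graph R X p d N m k) (s : X) (v : 'rV[R]_(N + m)) : R :=
  loss G s (downstream G v).

Definition batch_loss (R : realType) (X : Type) (p d N m k n : nat)
    (G : hybrid_graph R X p d N m k) (s : 'I_n -> X)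
    (Q : 'rV[R]_d -> 'rV[R]_N) (w : 'rV[R]_p) : R :=
  n%:R^-1 * \sum_i head_loss G (s i)
     (row_mx (Q (upstream G (s i) w)) (bypass G (s i) w)).

Definition regular_at (R : realType) (X : Type) (p d N m k n : nat)
    (G : hybrid_graph R X p d N m k) (s : 'I_n -> X)
    (Q : 'rV[R]_d -> 'rV[R]_N) (w : 'rV[R]_p) : Prop :=
  forall i,
    [/\ differentiable (upstream G (s i)) w,
        differentiable (bypass G (s i)) w &
        C11_at (head_loss G (s i))
          (row_mx (Q (upstream G (s i) w)) (bypass G (s i) w))].

(* Main.v *)
(* Only finitely many points matter, so a map is replaced by the family of its
   values and Jacobians on the batch, and one studies the families that are
   limits of those of networks. Since sigma is C^1, they are stable under affine
   maps and under sigma. Since sigma' is continuous and not constant, Riemann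
   sums of sigma' approximate the increments [sigma (t + h) - sigma t], whose
   first order expansion yields the identity as a locally uniform limit of
   combinations of sigma'(a t + b); integrating, one layer of neurons
   approximates [t] and [t ^+ 2] together with their derivatives. This works for
   polynomial sigma too, at the price of depth. Hence every polynomial can be
   appended to the input, and Hermite interpolation by polynomials reaches any
   values and Jacobians at finitely many points.
   The second claim is the chain rule, the Lipschitz bound on the gradient of the
   loss head and the equivalence of norms in finite dimension. *)

Require Import Defs.
From HB Require Import structures.
From mathcomp Require Import all_boot all_order all_algebra.
From mathcomp Require Import all_classical all_reals all_analysis.
From mathcomp Require Import ring.

Set Implicit Arguments.
Unset Strict Implicit.
Unset Printing Implicit Defensive.

Import Order.TTheory GRing.Theory Num.Theory.
Import numFieldNormedType.Exports.

Local Open Scope classical_set_scope.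
Local Open Scope ring_scope.

(** * Matrix calculus *)

Section matrix_calculus.
Variable R : realType.

(** The norm on matrices is the largest absolute value of an entry, and 0 for an empty matrix,
    whence the condition [0 <= e]. *)
Lemma normmx_le m n (M : 'M[R]_(m, n)) (e : R) :
  0 <= e -> (`|M| <= e) <-> (forall i j, `|M i j| <= e).
Proof.
move=> e0; rewrite /Num.Def.normr/= mx_normrE; split.
  move=> /bigmax_leP[_ h] i j; exact: (h (i, j)).
by move=> h; apply/bigmax_leP; split => // -[i j] _; exact: h.
Qed.

Lemma ler_normmx m n (M : 'M[R]_(m, n)) i j : `|M i j| <= `|M|.
Proof. by apply (normmx_le M (normr_ge0 M)). Qed.

Lemma cvg_mx T (F : set_system T) (FF : Filter F) m n (M : T -> 'M[R]_(m, n))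
    (A : 'M[R]_(m, n)) :
  (forall i j, M t i j @[t --> F] --> A i j) -> M t @[t --> F] --> A.
Proof.
move=> MA; apply/cvgrPdist_le => /= e e0; near=> t.
apply/normmx_le; first exact: ltW.
move=> i j; rewrite !mxE; move: i j; near: t.
apply: filter_forall => i; apply: filter_forall => j.
exact: ((cvgrPdist_le _ _).1 (MA i j)).
Unshelve. all: by end_near. Qed.

Lemma cvg_coord T (F : set_system T) (FF : Filter F) m n (M : T -> 'M[R]_(m, n))
    (A : 'M[R]_(m, n)) i j :
  M t @[t --> F] --> A -> M t i j @[t --> F] --> A i j.
Proof.
move=> MA; apply: (@cvg_comp _ _ _ M (fun B : 'M[R]_(m, n) => B i j) _ _ _ MA).
exact: coord_continuous.
Qed.

Lemma cvg_mulmxr T (F : set_system T) (FF : Filter F) m n p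
    (M : T -> 'M[R]_(m, n)) (A : 'M[R]_(m, n)) (W : 'M[R]_(n, p)) :
  M t @[t --> F] --> A -> M t *m W @[t --> F] --> A *m W.
Proof.
move=> MA; apply: cvg_mx => i j; rewrite mxE.
under eq_fun do rewrite mxE.
apply: cvg_big => [|k _]; first exact: add_continuous.
apply: cvgMr_tmp; exact: cvg_coord.
Qed.

Lemma normmx_mulmx m n p (A : 'M[R]_(m, n)) (B : 'M[R]_(n, p)) :
  `|A *m B| <= n%:R * (`|A| * `|B|).
Proof.
apply/normmx_le; first by rewrite !mulr_ge0.
move=> i j; rewrite mxE (le_trans (ler_norm_sum _ _ _))//.
apply: (@le_trans _ _ (\sum_(k < n) `|A| * `|B|)).
  by apply: ler_sum => k _; rewrite normrM ler_pM// ler_normmx.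
by rewrite sumr_const card_ord mulr_natl.
Qed.

Lemma normmx_trmx m n (A : 'M[R]_(m, n)) : `|A^T| <= `|A|.
Proof. by apply/normmx_le => // i j; rewrite mxE ler_normmx. Qed.

Lemma normmx_row_mx m n p (A : 'M[R]_(m, n)) (B : 'M[R]_(m, p)) :
  `|row_mx A B| <= `|A| + `|B|.
Proof.
apply/normmx_le; first by rewrite addr_ge0.
move=> i j; rewrite mxE; case: fintype.split => k.
  by rewrite (le_trans (ler_normmx _ _ _))// lerDl.
by rewrite (le_trans (ler_normmx _ _ _))// lerDr.
Qed.

Lemma differentiable_rV (V : normedModType R) n (f : V -> 'rV[R]_n) a :
  (forall j, differentiable (fun v => f v 0 j) a) -> differentiable f a.
Proof.
move=> df.
pose g (j : 'I_n) : V -> 'rV[R]_n := fun v => f v 0 j *: delta_mx 0 j.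
have -> : f = \sum_(j < n) g j.
  by apply/funext => v; rewrite fct_sumE [LHS]row_sum_delta.
apply: differentiable_sum => j; exact: differentiableZl.
Qed.

Lemma differentiable_coord_comp (V : normedModType R) m n (f : V -> 'M[R]_(m, n))
    a i j :
  differentiable f a -> differentiable (fun v => f v i j) a.
Proof. by move=> df; exact: (differentiable_comp df (differentiable_coord _ _ _)). Qed.

Lemma continuous_mulmxr m n p (W : 'M[R]_(n, p)) :
  continuous (mulmxr W : 'M[R]_(m, n) -> 'M[R]_(m, p)).
Proof.
move=> A; apply: (@cvg_mulmxr _ (nbhs A) _ m n p id A W); exact: cvg_id.
Qed.

Lemma is_diff_affine_mx n k (W : 'M[R]_(n, k)) (b : 'rV[R]_k) (a : 'rV[R]_n) :
  is_diff a (fun y : 'rV[R]_n => y *m W + b) (mulmxr W : 'rV[R]_n -> 'rV[R]_k).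
Proof.
pose f : 'rV[R]_n -> 'rV[R]_k := mulmxr W.
have fW : is_diff a f f.
  apply: DiffDef; first exact/linear_differentiable/continuous_mulmxr.
  exact/diff_lin/continuous_mulmxr.
have -> : (fun y : 'rV[R]_n => y *m W + b) = f + cst b by apply/funext.
by apply: is_diff_eq (is_diffD fW (is_diff_cst b a)) _; rewrite addr0.
Qed.

Lemma differentiable_affine_mx n k (W : 'M[R]_(n, k)) (b : 'rV[R]_k) a :
  differentiable (fun y : 'rV[R]_n => y *m W + b) a.
Proof. by case: (is_diff_affine_mx W b a). Qed.

Lemma jacobian_affine_mx n k (W : 'M[R]_(n, k)) (b : 'rV[R]_k) a :
  jacobian (fun y => y *m W + b) a = W.
Proof.
apply/row_matrixP => i; rewrite rowE /jacobian mul_rV_lin1.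
by case: (is_diff_affine_mx W b a) => _ ->; rewrite rowE.
Qed.

(** With row vectors every Jacobian is transposed, so the factors of the chain rule appear in the
    order of application. *)
Lemma jacobian_comp m n p (f : 'rV[R]_m -> 'rV[R]_n) (g : 'rV[R]_n -> 'rV[R]_p) a :
  differentiable f a -> differentiable g (f a) ->
  jacobian (fun v => g (f v)) a = jacobian f a *m jacobian g (f a).
Proof.
move=> df dg; apply/row_matrixP => i; rewrite !rowE mulmxA /jacobian !mul_rV_lin1.
by rewrite (diff_comp df dg).
Qed.

Lemma derive_coord m n (f : 'rV[R]_m -> 'rV[R]_n) a v j :
  differentiable f a -> 'D_v (fun y => f y 0 j) a = (v *m jacobian f a) 0 j.
Proof.
move=> df; rewrite -deriveEjacobian// derive_mx ?mxE//.
exact: diff_derivable.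
Qed.

Section map_mx.
Variable sigma : R -> R.
Hypothesis dsigma : forall t, derivable sigma t 1.

Lemma differentiable_map_mx n (a : 'rV[R]_n) : differentiable (map_mx sigma : 'rV_n -> 'rV_n) a.
Proof.
apply: differentiable_rV => j.
under eq_fun do rewrite mxE.
apply: (differentiable_comp (@differentiable_coord _ _ _ a 0 j)).
exact/derivable1_diffP.
Qed.

Lemma jacobian_map_mx n (a : 'rV[R]_n) :
  jacobian (map_mx sigma : 'rV_n -> 'rV_n) a = diag_mx (map_mx sigma^`()%classic a).
Proof.
apply/matrixP => i j.
have -> : jacobian (map_mx sigma : 'rV_n -> 'rV_n) a i j =
    ((delta_mx 0 i : 'rV_n) *m jacobian (map_mx sigma : 'rV_n -> 'rV_n) a) 0 j.
  by rewrite -rowE [RHS]mxE.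
rewrite -derive_coord; last exact: differentiable_map_mx.
under eq_fun do rewrite mxE.
have dc := @differentiable_coord _ _ _ a 0 j.
have ds : differentiable sigma (a 0 j) by exact/derivable1_diffP.
rewrite deriveE; last exact: (differentiable_comp dc ds).
rewrite (diff_comp dc ds)/= diff1E//= -[X in X *: _]deriveE//.
suff -> : 'D_(delta_mx 0 i) (fun N : 'rV[R]_n => N 0 j) a = (i == j)%:R.
  by rewrite !mxE; case: eqVneq => [->|_]; rewrite ?scale1r ?scale0r.
have /matrixP/(_ 0 j) := derive_mx (@derivable_id _ _ a (delta_mx 0 i)).
by rewrite derive_id !mxE eqxx /= eq_sym => <-.
Qed.

Lemma differentiable_layer n k (W : 'M[R]_(n, k)) (b : 'rV_k) (a : 'rV_n) :
  differentiable (fun y => map_mx sigma (y *m W + b)) a.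
Proof.
exact: (differentiable_comp (differentiable_affine_mx W b a)
  (differentiable_map_mx _)).
Qed.

Lemma differentiable_mlp_eval m n (net : mlp R m n) (a : 'rV_n) :
  differentiable (mlp_eval sigma net) a.
Proof.
elim: net a => [k W b|k l W b net IH] a /=; first exact: differentiable_affine_mx.
exact: (differentiable_comp (differentiable_layer W b a) (IH _)).
Qed.
End map_mx.
End matrix_calculus.

(** * Neurons of one variable *)

Section scalar_approximation.
Variable R : realType.

(** Mean value theorem with [a] and [b] in either order. Only the distance from the intermediate
    point to [a] is used below. *)
Lemma mvt_between (f : R -> R) (a b : R) : (forall t, derivable f t 1) ->
  exists2 c, `|c - a| <= `|b - a| & f b - f a = f^`()%classic c * (b - a).
Proof.
move=> df.
have is_df (t : R) : is_derive t 1 f (f^`()%classic t).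
  by rewrite derive1E; exact/derivableP.
have cf : continuous f.
  by move=> t; apply/differentiable_continuous/derivable1_diffP.
have [ab|ba] := leP a b.
  have [|c] := @MVT_segment R f f^`()%classic a b ab (fun t _ => is_df t).
    exact: continuous_subspaceT.
  rewrite in_itv/= => /andP[ac cb] ?; exists c => //.
  by rewrite !ger0_norm ?subr_ge0// lerD2r.
have [|c] := @MVT_segment R f f^`()%classic b a (ltW ba) (fun t _ => is_df t).
  exact: continuous_subspaceT.
rewrite in_itv/= => /andP[bc ca] E; exists c; last first.
  by rewrite -opprB E -mulrN opprB.
by rewrite !ler0_norm ?subr_le0 ?(ltW ba)// lerN2 lerD2r.
Qed.

(** Heine's theorem on [[- M, M]], where [v] may leave the segment. It comes from the near-covering
    form of compactness, with [d] running along the filter [0^'+]. *)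
Lemma continuous_unif_segment (g : R -> R) (M e : R) : continuous g -> 0 < e ->
  exists2 d, 0 < d & forall u v, `|u| <= M -> `|v - u| <= d -> `|g v - g u| <= e.
Proof.
move=> cg e0.
have := (@compact_near_coveringP R `[- M, M]%classic).1 (@segment_compact _ _ _).
move=> /(_ R 0^'+ (fun d u => forall v, `|v - u| <= d -> `|g v - g u| <= e)).
case=> [x _|d /= d0 H].
- have e20 : 0 < e / 2 by rewrite divr_gt0.
  have /cvgrPdist_le/(_ _ e20)/nbhs_ballP[r /= r0 Hr] := cg x.
  have r20 : 0 < r / 2 by rewrite divr_gt0.
  exists (ball x (r / 2), [set d | d < r / 2]) => /=.
    split; first exact: nbhsx_ballx.
    exact: nbhs_right_lt.
  move=> [u d] [/= xu dr] v vu.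
  have gu : `|g x - g u| <= e / 2.
    by apply: Hr; apply: le_ball xu; rewrite ler_pdivrMr// ler_pMr// ler1n.
  have gv : `|g x - g v| <= e / 2.
    apply: Hr; rewrite /ball/= (splitr r) -(subrKA u).
    rewrite (le_lt_trans (ler_normD _ _))// ltrD// distrC.
    exact: le_lt_trans vu dr.
  by rewrite (splitr e) -(subrKA (g x)) (le_trans (ler_normD _ _))// lerD// distrC.
(* Here [d] is the radius of a neighbourhood of 0, and [d / 2] is a positive point inside it. *)
exists (d / 2); first by rewrite divr_gt0.
move=> u v uM; apply: H => //=.
- by rewrite sub0r normrN gtr0_norm ?divr_gt0// ltr_pdivrMr// ltr_pMr// ltr1n.
- by rewrite divr_gt0.
- by rewrite in_itv/= -ler_norml.
Qed.

(* [(c, a, b)] stands for the neuron [t |-> c * g (a * t + b)]. *)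
Definition neurons (g : R -> R) (s : seq (R * R * R)) (t : R) : R :=
  \sum_(z <- s) z.1.1 * g (z.1.2 * t + z.2).

Definition scale_neuron (c a : R) (z : R * R * R) : R * R * R :=
  (c * z.1.1, a * z.1.2, z.2).

Lemma neurons_cat g s1 s2 t :
  neurons g (s1 ++ s2) t = neurons g s1 t + neurons g s2 t.
Proof. by rewrite /neurons big_cat. Qed.

Lemma neurons_scale g c a s t :
  neurons g [seq scale_neuron c a z | z <- s] t = c * neurons g s (a * t).
Proof.
rewrite /neurons big_map mulr_sumr; apply: eq_bigr => z _ /=.
by rewrite -mulrA [z.1.2 * _]mulrCA !mulrA.
Qed.

(** Locally uniform approximation by combinations of neurons. Slopes are kept nonzero because
    neurons are later integrated one by one, which divides by the slope. *)
Definition approximable (g h : R -> R) := forall M e : R, 0 < e ->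
  exists2 s, all (fun z => z.1.2 != 0) s &
    forall t, `|t| <= M -> `|neurons g s t - h t| <= e.

Lemma approximableD g h1 h2 : approximable g h1 -> approximable g h2 ->
  approximable g (fun t => h1 t + h2 t).
Proof.
move=> a1 a2 M e e0; have e20 : 0 < e / 2 by rewrite divr_gt0.
have [s1 s10 H1] := a1 M _ e20; have [s2 s20 H2] := a2 M _ e20.
exists (s1 ++ s2) => [|t tM]; first by rewrite all_cat s10.
rewrite neurons_cat opprD addrACA (splitr e).
by rewrite (le_trans (ler_normD _ _))// lerD// ?H1 ?H2.
Qed.

Lemma approximable_scale g h c a : a != 0 -> approximable g h ->
  approximable g (fun t => c * h (a * t)).
Proof.
move=> a0 ah M e e0.
(* Dividing by [|c| + 1] instead of [|c|] covers the case [c = 0]. *)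
have c0 : 0 < `|c| + 1 by rewrite ltr_wpDl.
have [s s0 H] := ah (`|a| * M) (e / (`|c| + 1)) (divr_gt0 e0 c0).
exists [seq scale_neuron c a z | z <- s] => [|t tM].
  by rewrite all_map; apply: sub_all s0 => z /= z0; rewrite mulf_neq0.
rewrite neurons_scale -mulrBr normrM.
apply: (@le_trans _ _ ((`|c| + 1) * (e / (`|c| + 1)))).
  by rewrite ler_pM// ?lerDl// H// normrM ler_wpM2l.
by rewrite mulrC divfK// gt_eqF.
Qed.

Lemma approximable_lim g h :
  (forall M e : R, 0 < e -> exists2 h', approximable g h' &
     forall t, `|t| <= M -> `|h' t - h t| <= e) -> approximable g h.
Proof.
move=> ah M e e0; have e20 : 0 < e / 2 by rewrite divr_gt0.
have [h' /(_ M _ e20)[s s0 H] H'] := ah M _ e20.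
exists s => // t tM; rewrite -(subrKA (h' t)) (splitr e).
by rewrite (le_trans (ler_normD _ _))// lerD// ?H ?H'.
Qed.

(** * The identity and the square from the derivative of the activation *)

Section activation.
Variable sigma : R -> R.
Hypotheses (sigma_C1 : C1_activation sigma)
           (sigma_nonlinear : nonlinear_activation sigma).
Let g : R -> R := sigma^`()%classic.
Let dsigma : forall t, derivable sigma t 1 := sigma_C1.1.
Let g_cont : continuous g := sigma_C1.2.

(** By the mean value theorem, a constant derivative would make [sigma] affine. *)
Lemma derive1_nonconstant : exists u v, u < v /\ g u != g v.
Proof.
apply: contrapT => H; apply: sigma_nonlinear; exists (g 0), (sigma 0) => t.
have gE c : g c = g 0.
  apply/eqP/negP => /negP gc; apply: H.
  have [c0|c0|c0] := ltgtP c 0; first by exists c, 0.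
    by exists 0, c; rewrite eq_sym.
  by rewrite c0 eqxx in gc.
have [c _] := mvt_between 0 t dsigma.
by rewrite -/g gE subr0 => <-; rewrite subrK.
Qed.

(** Near a point [u] with [g u != 0], a neuron of small slope stays close to its value at [u] all
    over [[- M, M]]. That a single neuron suffices lets a layer later carry its inputs through
    coordinate by coordinate. *)
Lemma approximable_cst_neuron (M e : R) : 0 < e ->
  exists2 z, z.1.2 != 0 &
    forall t, `|t| <= M -> `|neurons g [:: z] t - 1| <= e.
Proof.
move=> e0.
have [u gu0] : exists u, g u != 0.
  have [u [v [_]]] := derive1_nonconstant.
  have [-> v0|u0 _] := eqVneq (g u) 0; last by exists u.
  by exists v; rewrite eq_sym.
have eg : 0 < e * `|g u| by rewrite mulr_gt0 ?normr_gt0.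
have /cvgrPdist_le/(_ _ eg)/nbhs_ballP[r /= r0 Hr] := @g_cont u.
have M1 : 0 < `|M| + 1 by rewrite ltr_wpDl.
exists ((g u)^-1, r / (`|M| + 1), u) => /= [|t tM].
  by rewrite mulf_neq0 ?invr_eq0// gt_eqF.
rewrite /neurons big_seq1/= -[X in _ - X](mulVf gu0) -mulrBr normrM normfV.
rewrite ler_pdivrMl ?normr_gt0// [leRHS]mulrC distrC; apply: Hr; rewrite /ball/=.
rewrite opprD addrCA subrr addr0 normrN normrM (gtr0_norm (divr_gt0 r0 M1)).
rewrite -mulrA gtr_pMr// mulrC ltr_pdivrMr// mul1r.
by rewrite (le_lt_trans tM)// (le_lt_trans (ler_norm _))// ltrDl.
Qed.

Lemma approximable_cst c : approximable g (fun=> c).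
Proof.
have a1 : approximable g (fun=> 1).
  move=> M e e0; have [z z0 H] := approximable_cst_neuron M e0.
  by exists [:: z] => //=; rewrite z0.
have := approximable_scale c (oner_neq0 R) a1.
by under eq_fun do rewrite mulr1.
Qed.

(* The increment is the integral of [g] over [t + u, t + u + h], hence a limit
   of left Riemann sums, whose terms are translates of [g]. *)
Lemma approximable_increment (u h : R) : 0 < h ->
  approximable g (fun t => sigma (t + u + h) - sigma (t + u)).
Proof.
move=> h0 M e e0.
(* The sampling points [t + u + k * (h / n)] stay in the segment of radius [M + |u| + h]. An error
   [e / h] on each of the [n] steps of length [h / n] adds up to [e]. *)
have [d d0 Hd] := continuous_unif_segment (M + `|u| + h) g_cont (divr_gt0 e0 h0).
have [n n0 hnd] : exists2 n, 0 < n%:R :> R & h / n%:R <= d.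
  exists (Num.truncn (h / d)).+1; first by rewrite ltr0n.
  by rewrite ler_pdivrMr// mulrC -ler_pdivrMr// ltW// truncnS_gt.
have hn0 : 0 < h / n%:R by rewrite divr_gt0.
exists [seq (h / n%:R, 1, u + k%:R * (h / n%:R)) | k <- iota 0 n].
  by rewrite all_map; apply/allP => k _ /=; rewrite oner_neq0.
move=> t tM; rewrite /neurons big_map /=.
pose F k := sigma (t + u + k%:R * (h / n%:R)).
have -> : sigma (t + u + h) - sigma (t + u) = \sum_(0 <= k < n) (F k.+1 - F k).
  by rewrite telescope_sumr// /F mul0r addr0 mulrC divfK// gt_eqF.
rewrite /index_iota subn0 -sumrB (le_trans (ler_norm_sum _ _ _))//.
apply: (@le_trans _ _ (\sum_(k <- iota 0 n) (h / n%:R * (e / h)))); last first.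
  rewrite big_const_seq count_predT size_iota iter_addr_0 -[_ *+ n]mulr_natr.
  suff -> : h / n%:R * (e / h) * n%:R = e by [].
  by field; rewrite !gt_eqF.
rewrite big_seq [leRHS]big_seq; apply: ler_sum => k; rewrite mem_iota add0n => /andP[_ kn].
have [c ck] := mvt_between (t + u + k%:R * (h / n%:R))
  (t + u + k.+1%:R * (h / n%:R)) dsigma.
rewrite -/g -/(F _) => ->.
have kE : t + u + k.+1%:R * (h / n%:R) - (t + u + k%:R * (h / n%:R)) = h / n%:R.
  by rewrite -natr1; ring.
rewrite kE mulrC -mulrBl normrM mulrC (gtr0_norm hn0) ler_pM2l// mul1r addrA.
rewrite distrC Hd//.
  rewrite (le_trans (ler_normD _ _))// lerD//.
    by rewrite (le_trans (ler_normD _ _))// lerD.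
  rewrite normrM ger0_norm// (gtr0_norm hn0) mulrCA ler_piMr// ?(ltW h0)//.
  by rewrite ler_pdivrMr// mul1r ler_nat ltnW.
by rewrite (le_trans ck)// kE gtr0_norm.
Qed.

(** By the mean value theorem the remainder is [(g c - g u) * s] with [c] close to [u], and [g] is
    continuous at [u]. *)
Lemma derive1_expansion (u e : R) : 0 < e -> exists2 d, 0 < d &
  forall s, `|s| <= d -> `|sigma (s + u) - sigma u - g u * s| <= e * `|s|.
Proof.
move=> e0.
have /cvgrPdist_le/(_ _ e0)/nbhs_ballP[r /= r0 Hr] := @g_cont u.
exists (r / 2) => [|s sr]; first by rewrite divr_gt0.
have [c cu ->] := mvt_between u (s + u) dsigma.
rewrite addrK in cu *; rewrite -/g -mulrBl normrM ler_wpM2r// distrC; apply: Hr.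
rewrite /ball/= distrC (le_lt_trans cu)// (le_lt_trans sr)//.
by rewrite ltr_pdivrMr// ltr_pMr// ltr1n.
Qed.

(** The increment [D] is approximable and its derivative at 0 is [k = g v - g u], which is nonzero.
    Hence [(D (a * t) - D 0) / (k * a)] tends to [t] as [a] tends to 0, uniformly on [[- M, M]]. *)
Lemma approximable_id : approximable g id.
Proof.
have [u [v [uv guv]]] := derive1_nonconstant.
pose k := g v - g u.
have k0 : k != 0 by rewrite subr_eq0 eq_sym.
pose D t := sigma (t + v) - sigma (t + u).
have aD : approximable g D.
  have vu : 0 < v - u by rewrite subr_gt0.
  have := approximable_increment u vu.
  by under eq_fun do rewrite -addrA (addrC u) subrK.
apply: approximable_lim => M e e0.
have M1 : 0 < `|M| + 1 by rewrite ltr_wpDl.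
(* Two remainders of size at most [e' * |a * t|], divided by [|k * a|], leave [e * |t| / (|M| + 1)],
   which is at most [e]. *)
pose e' := e * `|k| / (2 * (`|M| + 1)).
have e'0 : 0 < e' by rewrite divr_gt0// mulr_gt0// normr_gt0.
have [d1 d10 H1] := derive1_expansion u e'0.
have [d2 d20 H2] := derive1_expansion v e'0.
pose a := Num.min d1 d2 / (`|M| + 1).
have a0 : 0 < a by rewrite divr_gt0// lt_min d10.
exists (fun t => (k * a)^-1 * D (a * t) + (- ((k * a)^-1 * D 0))).
  apply: approximableD; last exact: approximable_cst.
  by apply: approximable_scale => //; rewrite gt_eqF.
move=> t tM.
have atM : `|a * t| <= Num.min d1 d2.
  rewrite normrM gtr0_norm// /a -mulrA ler_piMr//.
    by rewrite le_min !ltW.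
  by rewrite mulrC ler_pdivrMr// mul1r (le_trans tM)// (le_trans (ler_norm _))// lerDl.
move: (atM); rewrite le_min => /andP[/H1 {}H1 /H2 {}H2].
have ka0 : k * a != 0 by rewrite mulf_neq0// gt_eqF.
have -> : (k * a)^-1 * D (a * t) - (k * a)^-1 * D 0 - t = (k * a)^-1 *
   ((sigma (a * t + v) - sigma v - g v * (a * t)) -
    (sigma (a * t + u) - sigma u - g u * (a * t))).
  by rewrite /D !add0r /k; field; rewrite -/k k0 gt_eqF.
rewrite normrM normfV ler_pdivrMl ?normr_gt0//.
apply: (@le_trans _ _ (2 * (e' * `|a * t|))).
  by rewrite mulr_natl mulr2n (le_trans (ler_normB _ _))// lerD.
rewrite (normrM k) (normrM a) (gtr0_norm a0) /e'.
have -> : 2 * (e * `|k| / (2 * (`|M| + 1)) * (a * `|t|)) =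
  (`|k| * a * e) * (`|t| / (`|M| + 1)) by field; rewrite gt_eqF.
rewrite ler_piMr//; first by rewrite mulr_ge0 ?(ltW e0)// mulr_ge0// ltW.
by rewrite ler_pdivrMr// mul1r (le_trans tM)// (le_trans (ler_norm _))// lerDl.
Qed.

(** Chain rule: read with [g] in place of [sigma], this triple is the derivative of the neuron
    [z]. *)
Definition deriv_neuron (z : R * R * R) : R * R * R := (z.1.1 * z.1.2, z.1.2, z.2).

Lemma is_derive_neurons s (t : R) :
  is_derive t 1 (neurons sigma s) (neurons g (map deriv_neuron s) t).
Proof.
elim: s => [|z s IH].
  rewrite /= /neurons big_nil (_ : (fun _ => _) = cst 0); first exact: is_derive_cst.
  by apply/funext => ?; rewrite big_nil.
rewrite /= /neurons big_cons -/(neurons _ _ _).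
have -> : (fun t => \sum_(z0 <- z :: s) z0.1.1 * sigma (z0.1.2 * t + z0.2)) =
    (z.1.1 \*: (sigma \o (fun t => z.1.2 * t + z.2))) + neurons sigma s.
  by apply/funext => ?; rewrite big_cons.
apply: is_deriveD.
have da : is_derive t 1 (fun t : R => z.1.2 * t + z.2) z.1.2.
  have : is_derive t 1 (z.1.2 \*: (id : R -> R) + cst z.2) (z.1.2 *: 1 + 0).
    exact: is_deriveD.
  by rewrite addr0 [_ *: _]mulr1.
have ds : is_derive (z.1.2 * t + z.2) 1 sigma (g (z.1.2 * t + z.2)).
  by rewrite /g derive1E; exact/derivableP.
have dc := @is_derive1_comp _ sigma (fun t : R => z.1.2 * t + z.2) t _ _ ds da.
by apply: (is_derive_eq (is_deriveZ _ dc)); rewrite /= /GRing.scale /= [g _ * _]mulrC mulrA.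
Qed.

(** Dividing each coefficient by its slope integrates [s]; the constant [c] matches the primitives
    at 0, and the mean value theorem bounds their distance by [e * |t|]. *)
Lemma neurons_primitive phi psi s (M e : R) :
  (forall t : R, is_derive t 1 phi (psi t)) -> all (fun z => z.1.2 != 0) s ->
  (forall t, `|t| <= M -> `|neurons g s t - psi t| <= e) ->
  exists s' c, [/\ size s' = size s,
    forall t, `|t| <= M -> `|neurons sigma s' t + c - phi t| <= e * `|t| &
    forall t, `|t| <= M -> `|neurons g (map deriv_neuron s') t - psi t| <= e].
Proof.
move=> dphi s0 H; pose s' := [seq (z.1.1 / z.1.2, z.1.2, z.2) | z <- s].
have s'E : map deriv_neuron s' = s.
  rewrite -map_comp -[RHS]map_id; apply/eq_in_map => -[[c a] b] /(allP s0) /= a0.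
  by rewrite /deriv_neuron /= divfK.
exists s', (phi 0 - neurons sigma s' 0); split => [|t tM|]; first exact: size_map.
  have df (v : R) : is_derive v 1 (neurons sigma s' - phi) (neurons g s v - psi v).
    by apply: is_deriveB; rewrite -s'E; exact: is_derive_neurons.
  have [c] := @mvt_between (neurons sigma s' - phi) 0 t (fun v => @ex_derive _ _ _ _ _ _ _ (df v)).
  rewrite !subr0 derive1E derive_val => ct.
  rewrite -[(_ - _ : _ -> _) t]/(neurons sigma s' t - phi t).
  rewrite -[(_ - _ : _ -> _) 0]/(neurons sigma s' 0 - phi 0) => E.
  have -> : neurons sigma s' t + (phi 0 - neurons sigma s' 0) - phi t =
    neurons sigma s' t - phi t - (neurons sigma s' 0 - phi 0) by ring.
  by rewrite E normrM ler_wpM2r// H// (le_trans ct).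
by rewrite s'E.
Qed.

(** The [n]-th combination has error at most [1 / (n + 1)] on derivatives for [|t| <= n], which
    gives pointwise limits of values and derivatives together. The predicate [Q] keeps track of the
    number of neurons. *)
Lemma neurons_limit (Q : pred nat) (phi psi : R -> R) :
  (forall t : R, is_derive t 1 phi (psi t)) ->
  (forall M e : R, 0 < e -> exists s, [/\ Q (size s), all (fun z => z.1.2 != 0) s &
     forall t, `|t| <= M -> `|neurons g s t - psi t| <= e]) ->
  exists (s : nat -> seq (R * R * R)) (c : nat -> R),
    [/\ forall n, Q (size (s n)),
     forall t, neurons sigma (s n) t + c n @[n --> \oo] --> phi t &
     forall t, neurons g (map deriv_neuron (s n)) t @[n --> \oo] --> psi t].
Proof.
move=> dphi H.
have /choice[sc Hsc] : forall n : nat, exists sc : seq (R * R * R) * R,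
    [/\ Q (size sc.1),
    forall t, `|t| <= n%:R -> `|neurons sigma sc.1 t + sc.2 - phi t| <= n.+1%:R^-1 * `|t| &
    forall t, `|t| <= n%:R -> `|neurons g (map deriv_neuron sc.1) t - psi t| <= n.+1%:R^-1].
  move=> n; have n0 : 0 < (n.+1%:R)^-1 :> R by rewrite invr_gt0 ltr0n.
  have [s [Qs s0 Hs]] := H n%:R _ n0.
  have [s' [c [s'E H1 H2]]] := neurons_primitive dphi s0 Hs.
  by exists (s', c); rewrite /= s'E.
exists (fun n => (sc n).1), (fun n => (sc n).2); split => [n|t|t].
- by have [] := Hsc n.
- apply/cvgrPdist_le => /= e e0; near=> n; rewrite distrC.
  have [_ H1 _] := Hsc n; apply: (le_trans (H1 t _)).
    by near: n; exact: nbhs_infty_ger.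
  rewrite ler_pdivrMl ?ltr0n// -ler_pdivrMr// (@le_trans _ _ n%:R) ?ler_nat//.
  by near: n; exact: nbhs_infty_ger.
- apply/cvgrPdist_le => /= e e0; near=> n; rewrite distrC.
  have [_ _ H2] := Hsc n; apply: (le_trans (H2 t _)).
    by near: n; exact: nbhs_infty_ger.
  rewrite -[_^-1]mulr1 ler_pdivrMl ?ltr0n// -ler_pdivrMr// (@le_trans _ _ n%:R) ?ler_nat//.
  by near: n; exact: nbhs_infty_ger.
Unshelve. all: by end_near. Qed.

Lemma neuron_limit_id : exists (z : nat -> R * R * R) (c : nat -> R),
  (forall t, neurons sigma [:: z n] t + c n @[n --> \oo] --> t) /\
  (forall t, neurons g [:: deriv_neuron (z n)] t @[n --> \oo] --> (1 : R)).
Proof.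
have [M e e0|s [c [s1 H1 H2]]] := @neurons_limit (pred1 1%N) id (cst 1) (fun=> is_derive_id _ _).
  have [z z0 Hz] := approximable_cst_neuron M e0.
  by exists [:: z]; rewrite /= z0.
exists (fun n => head (0, 0, 0) (s n)), c.
have sE n : s n = [:: head (0, 0, 0) (s n)] by case: (s n) (s1 n) => [|z []].
by split => t; [have := H1 t | have := H2 t]; under eq_fun do rewrite sE.
Qed.

(** The derivative [2 * t] is a multiple of the identity, hence approximable; the square is its
    primitive. *)
Lemma neurons_limit_sqr : exists (s : nat -> seq (R * R * R)) (c : nat -> R),
  (forall t, neurons sigma (s n) t + c n @[n --> \oo] --> t ^+ 2) /\
  (forall t, neurons g (map deriv_neuron (s n)) t @[n --> \oo] --> 2 * t).
Proof.
have dsq (t : R) : is_derive t 1 (fun t : R => t ^+ 2) (2 * t).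
  have := is_deriveX 2 (is_derive_id t (1 : R)).
  rewrite exprfctE => H; apply: (is_derive_eq H).
  by rewrite expr1 [_ *: _]mulr1.
have [M e e0|s [c [_ H1 H2]]] := @neurons_limit predT _ _ dsq.
  have [s s0 Hs] := approximable_scale 2 (oner_neq0 R) approximable_id M e0.
  by exists s; split => // t /Hs; rewrite mul1r.
by exists s, c.
Qed.

End activation.
End scalar_approximation.
Arguments deriv_neuron {R} z.

(** * Values and Jacobians reachable by networks *)

Lemma cvg_row_mx (R : realType) T (F : set_system T) (FF : Filter F) m n p
    (A : T -> 'M[R]_(m, n)) (B : T -> 'M[R]_(m, p)) (A0 : 'M[R]_(m, n)) (B0 : 'M[R]_(m, p)) :
  A t @[t --> F] --> A0 -> B t @[t --> F] --> B0 ->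
  row_mx (A t) (B t) @[t --> F] --> row_mx A0 B0.
Proof.
move=> cA cB; apply: cvg_mx => i j; rewrite mxE.
under eq_fun do rewrite mxE.
by case: fintype.split => k; exact: cvg_coord.
Qed.

Lemma cvg_scalar_mx (R : realType) T (F : set_system T) (FF : Filter F) n
    (f : T -> R) (l : R) :
  f t @[t --> F] --> l -> (f t)%:M @[t --> F] --> (l%:M : 'M[R]_n).
Proof.
move=> fl; apply: cvg_mx => i j; rewrite mxE.
by under eq_fun do rewrite mxE; exact: cvgMn.
Qed.

(** The output layer has no activation, so an affine map applied after it merges with it at no cost
    in depth. *)
Fixpoint mlp_post (R : realType) m p n (net : mlp R m n) :
    'M[R]_(m, p) -> 'rV[R]_p -> mlp R p n :=
  match net in mlp _ _ n return 'M[R]_(m, p) -> 'rV[R]_p -> mlp R p n with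
  | OutputLayer _ W b => fun V c => OutputLayer (W *m V) (b *m V + c)
  | HiddenLayer _ _ W b net' => fun V c => HiddenLayer W b (mlp_post net' V c)
  end.

Fixpoint mlp_activate (R : realType) m n (net : mlp R m n) : mlp R m n :=
  match net with
  | OutputLayer _ W b => HiddenLayer W b (OutputLayer 1%:M 0)
  | HiddenLayer _ _ W b net' => HiddenLayer W b (mlp_activate net')
  end.

Lemma mlp_eval_post (R : realType) (sigma : R -> R) m p n (net : mlp R m n)
    (V : 'M[R]_(m, p)) c x :
  mlp_eval sigma (mlp_post net V c) x = mlp_eval sigma net x *m V + c.
Proof.
elim: net x => [k W b|k l W b net IH] x /=; last exact: IH.
by rewrite mulmxDl mulmxA addrA.
Qed.

Lemma mlp_eval_activate (R : realType) (sigma : R -> R) m n (net : mlp R m n) x :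
  mlp_eval sigma (mlp_activate net) x = map_mx sigma (mlp_eval sigma net x).
Proof.
by elim: net x => [k W b|k l W b net IH] x /=; [rewrite mulmx1 addr0|exact: IH].
Qed.

Section reachable.
Variables (R : realType) (sigma : R -> R).
Hypotheses (sigma_C1 : C1_activation sigma)
           (sigma_nonlinear : nonlinear_activation sigma).
Let g : R -> R := sigma^`()%classic.
Let dsigma : forall t, derivable sigma t 1 := sigma_C1.1.
Variables (d q : nat) (x : 'I_q -> 'rV[R]_d).

(** Closure of the set of families of values and Jacobians that networks take on the batch. *)
Definition reachable k (Y : 'I_q -> 'rV[R]_k) (D : 'I_q -> 'M[R]_(d, k)) :=
  forall e : R, 0 < e -> exists net : mlp R k d, forall i,
    `|mlp_eval sigma net (x i) - Y i| <= e /\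
    `|jacobian (mlp_eval sigma net) (x i) - D i| <= e.

Lemma reachable_seq k (Y : 'I_q -> 'rV[R]_k) D : reachable Y D ->
  exists net : nat -> mlp R k d, forall i,
    mlp_eval sigma (net n) (x i) @[n --> \oo] --> Y i /\
    jacobian (mlp_eval sigma (net n)) (x i) @[n --> \oo] --> D i.
Proof.
move=> YD.
have /choice[net Hnet] : forall n : nat, exists net : mlp R k d, forall i,
    `|mlp_eval sigma net (x i) - Y i| <= n.+1%:R^-1 /\
    `|jacobian (mlp_eval sigma net) (x i) - D i| <= n.+1%:R^-1.
  by move=> n; apply: YD; rewrite invr_gt0 ltr0n.
exists net => i; split; apply/cvgrPdist_le => /= e e0; near=> n; rewrite distrC.
- have [H _] := Hnet n i; apply: (le_trans H).
  rewrite -[_^-1]mulr1 ler_pdivrMl ?ltr0n// -ler_pdivrMr// (@le_trans _ _ n%:R) ?ler_nat//.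
  by near: n; exact: nbhs_infty_ger.
- have [_ H] := Hnet n i; apply: (le_trans H).
  rewrite -[_^-1]mulr1 ler_pdivrMl ?ltr0n// -ler_pdivrMr// (@le_trans _ _ n%:R) ?ler_nat//.
  by near: n; exact: nbhs_infty_ger.
Unshelve. all: by end_near. Qed.

(** A closure is closed. Since the batch is finite, one index [n] serves all samples. *)
Lemma reachable_lim k (Y : 'I_q -> 'rV[R]_k) D Yn Dn :
  (forall n : nat, reachable (Yn n) (Dn n)) ->
  (forall i, Yn n i @[n --> \oo] --> Y i) ->
  (forall i, Dn n i @[n --> \oo] --> D i) -> reachable Y D.
Proof.
move=> H HY HD e e0; have e20 : 0 < e / 2 by rewrite divr_gt0.
have : \forall n \near \oo, forall i, `|Y i - Yn n i| <= e / 2 /\ `|D i - Dn n i| <= e / 2.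
  apply: filter_forall => i.
  have /cvgrPdist_le/(_ _ e20) H1 := HY i.
  have /cvgrPdist_le/(_ _ e20) H2 := HD i.
  by near=> n; split; near: n.
move=> [n _ /(_ n (leqnn n)) Hn].
have [net Hnet] := H n _ e20; exists net => i.
have [H1 H2] := Hn i; have [H3 H4] := Hnet i.
rewrite (splitr e); split.
- by rewrite -(subrKA (Yn n i)) (le_trans (ler_normD _ _))// lerD// distrC.
- by rewrite -(subrKA (Dn n i)) (le_trans (ler_normD _ _))// lerD// distrC.
Unshelve. all: by end_near. Qed.

Lemma reachable_of_seq k (Y : 'I_q -> 'rV[R]_k) D (net : nat -> mlp R k d) :
  (forall i, mlp_eval sigma (net n) (x i) @[n --> \oo] --> Y i) ->
  (forall i, jacobian (mlp_eval sigma (net n)) (x i) @[n --> \oo] --> D i) ->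
  reachable Y D.
Proof.
apply: reachable_lim => n e e0; exists (net n) => i.
by rewrite !subrr !normr0 ltW.
Qed.

Lemma reachable_affine k l (Y : 'I_q -> 'rV[R]_k) D (V : 'M[R]_(k, l)) c :
  reachable Y D -> reachable (fun i => Y i *m V + c) (fun i => D i *m V).
Proof.
move=> /reachable_seq[net H].
apply: (@reachable_of_seq _ _ _ (fun n => mlp_post (net n) V c)) => i.
  under eq_fun do rewrite mlp_eval_post.
  apply: cvgD; last exact: cvg_cst.
  by apply: cvg_mulmxr; exact: (H i).1.
have E n : jacobian (mlp_eval sigma (mlp_post (net n) V c)) (x i) =
    jacobian (mlp_eval sigma (net n)) (x i) *m V.
  rewrite (funext (mlp_eval_post sigma (net n) V c)).
  rewrite (@jacobian_comp _ _ _ _ (mlp_eval sigma (net n)) (fun y => y *m V + c)).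
  - by rewrite jacobian_affine_mx.
  - exact: differentiable_mlp_eval.
  - exact: differentiable_affine_mx.
under eq_fun do rewrite E.
by apply: cvg_mulmxr; exact: (H i).2.
Qed.

(** Continuity of [sigma] passes the values to the limit; continuity of [g] does so for the diagonal
    factor that the chain rule adds to the Jacobians. *)
Lemma reachable_activate k (Y : 'I_q -> 'rV[R]_k) D :
  reachable Y D ->
  reachable (fun i => map_mx sigma (Y i)) (fun i => D i *m diag_mx (map_mx g (Y i))).
Proof.
move=> /reachable_seq[net H].
apply: (@reachable_of_seq _ _ _ (fun n => mlp_activate (net n))) => i.
  under eq_fun do rewrite mlp_eval_activate.
  apply: cvg_mx => a j; rewrite mxE; under eq_fun do rewrite mxE.
  apply: (@cvg_comp _ _ _ (fun n => mlp_eval sigma (net n) (x i) a j) sigma).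
    by apply: cvg_coord; exact: (H i).1.
  have cs : {for Y i a j, continuous sigma}.
    exact/differentiable_continuous/derivable1_diffP.
  exact: cs.
have E n : jacobian (mlp_eval sigma (mlp_activate (net n))) (x i) =
    jacobian (mlp_eval sigma (net n)) (x i) *m
    diag_mx (map_mx g (mlp_eval sigma (net n) (x i))).
  rewrite (funext (mlp_eval_activate sigma (net n))).
  rewrite (@jacobian_comp _ _ _ _ (mlp_eval sigma (net n)) (map_mx sigma)).
  - by rewrite jacobian_map_mx.
  - exact: differentiable_mlp_eval.
  - exact: differentiable_map_mx.
under eq_fun do rewrite E mul_mx_diag.
rewrite mul_mx_diag; apply: cvg_mx => a j.
rewrite mxE [X in _ * X]mxE; under eq_fun do rewrite mxE [X in _ * X]mxE.
apply: cvgM; first by apply: cvg_coord; exact: (H i).2.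
apply: (@cvg_comp _ _ _ (fun n => mlp_eval sigma (net n) (x i) 0 j) g).
  by apply: cvg_coord; exact: (H i).1.
exact: sigma_C1.2.
Qed.

Lemma reachable_input : reachable x (fun=> 1%:M).
Proof.
move=> e e0; exists (OutputLayer 1%:M 0) => i /=.
by rewrite jacobian_affine_mx mulmx1 addr0 !subrr !normr0 ltW.
Qed.

(** Matrix form of [neurons]: a hidden layer fed by the linear form [y *m a], with slopes, biases
    and output weights read from [s]. *)
Lemma neurons_mulmx k (y : 'rV[R]_k) (a : 'cV[R]_k) (h : R -> R) s (c : R) :
  map_mx h (y *m (a *m \row_(j < size s) (nth (0, 0, 0) s j).1.2)
            + \row_j (nth (0, 0, 0) s j).2) *m (\col_j (nth (0, 0, 0) s j).1.1) + c%:M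
  = (neurons h s ((y *m a) 0 0) + c)%:M.
Proof.
rewrite raddfD/=; congr (_ + _); apply/matrixP => i j; rewrite !ord1 !mxE eqxx mulr1n.
rewrite /neurons (big_nth (0, 0, 0)) big_mkord; apply: eq_bigr => l _.
rewrite mulmxA !mxE big_ord1 !mxE mulrC; congr (_ * h (_ + _)).
by rewrite mulrC.
Qed.

Lemma deriv_neurons_mulmx k m (y : 'rV[R]_k) (D : 'M[R]_(m, k)) (a : 'cV[R]_k) (h : R -> R) s :
  D *m (a *m \row_(j < size s) (nth (0, 0, 0) s j).1.2) *m
    diag_mx (map_mx h (y *m (a *m \row_(j < size s) (nth (0, 0, 0) s j).1.2)
            + \row_j (nth (0, 0, 0) s j).2)) *m (\col_j (nth (0, 0, 0) s j).1.1)
  = neurons h (map deriv_neuron s) ((y *m a) 0 0) *: (D *m a).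
Proof.
set r := \row__ _; set e := diag_mx _; set c := \col__ _.
have -> : D *m (a *m r) *m e *m c = D *m a *m (r *m e *m c) by rewrite !mulmxA.
suff -> : r *m e *m c = (neurons h (map deriv_neuron s) ((y *m a) 0 0))%:M.
  by rewrite mul_mx_scalar.
apply/matrixP => i j; rewrite !ord1 mul_mx_diag !mxE eqxx mulr1n.
rewrite /neurons big_map (big_nth (0, 0, 0)) big_mkord; apply: eq_bigr => l _ /=.
rewrite mulmxA !mxE big_ord1 !mxE mulrC mulrA; congr (_ * h (_ + _)).
by rewrite mulrC.
Qed.

(** One layer in two blocks: a single neuron per coordinate carries [Y i] through, while neurons fed
    by [Y i *m a] compute the square. Both are exact in the limit, together with their
    derivatives. *)
Lemma reachable_sqr k (Y : 'I_q -> 'rV[R]_k) D (a : 'cV[R]_k) :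
  reachable Y D ->
  reachable (fun i => row_mx (Y i) (((Y i *m a) 0 0) ^+ 2)%:M)
            (fun i => row_mx (D i) ((2 * (Y i *m a) 0 0) *: (D i *m a))).
Proof.
move=> YD.
have [z [c [z1 z2]]] := neuron_limit_id sigma_C1 sigma_nonlinear.
have [s [c' [s1 s2]]] := neurons_limit_sqr sigma_C1 sigma_nonlinear.
pose W n := row_mx (((z n).1.2)%:M) (a *m \row_(j < size (s n)) (nth (0, 0, 0) (s n) j).1.2).
pose b n := row_mx (const_mx (z n).2 : 'rV[R]_k) (\row_(j < size (s n)) (nth (0, 0, 0) (s n) j).2).
pose V n := block_mx (((z n).1.1)%:M : 'M[R]_k) 0 0
  (\col_(j < size (s n)) (nth (0, 0, 0) (s n) j).1.1).
pose e n := row_mx (const_mx (c n) : 'rV[R]_k) ((c' n)%:M : 'M[R]_1).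
(* For fixed [n] the layer acts on the limit family [Y], [D] itself; only afterwards does [n] tend
   to infinity. *)
have H n := reachable_affine (V n) (e n) (reachable_activate (reachable_affine (W n) (b n) YD)).
apply: (reachable_lim H) => i.
  rewrite /W /b /V /e.
  under eq_fun do rewrite mul_mx_row add_row_mx map_row_mx mul_row_block !mulmx0 addr0 add0r
    add_row_mx neurons_mulmx.
  apply: cvg_row_mx.
    apply: cvg_mx => u j.
    rewrite [X in X @ _ --> _](_ : _ = fun n => neurons sigma [:: z n] (Y i u j) + c n).
      exact: z1.
    apply/funext => n.
    by rewrite mul_mx_scalar mul_mx_scalar !mxE /neurons big_seq1 ord1.
  by apply: cvg_scalar_mx; exact: s1.
rewrite /W /b /V.
under eq_fun do rewrite !mul_mx_row add_row_mx map_row_mx diag_mx_row !mul_row_block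
    !mulmx0 !addr0 !add0r deriv_neurons_mulmx.
apply: cvg_row_mx.
  apply: cvg_mx => u j.
  have H2 := @cvgMl_tmp _ _ _ _ _ (D i u j) _ (z2 (Y i 0 j)); rewrite mulr1 in H2.
  rewrite [X in X @ _ --> _](_ : _ =
    fun n => D i u j * neurons g [:: deriv_neuron (z n)] (Y i 0 j)).
    exact: H2.
  apply/funext => n.
  by rewrite !mul_mx_scalar mul_mx_diag !mxE /neurons big_seq1 /= -/g; ring.
apply: cvgZr_tmp; exact: s2.
Qed.

End reachable.

(** * Hermite interpolation *)

Lemma col_sum_delta (R : realType) m n (A : 'M[R]_(m, n)) :
  A = \sum_l col l A *m delta_mx 0 l.
Proof.
apply/matrixP => i j; rewrite summxE (bigD1 j)//= big1 => [|l lj].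
  by rewrite addr0 mxE big_ord1 !mxE !eqxx mulr1.
by rewrite mxE big_ord1 !mxE eqxx eq_sym (negbTE lj) mulr0.
Qed.

Section learnable.
Variables (R : realType) (sigma : R -> R).
Hypotheses (sigma_C1 : C1_activation sigma)
           (sigma_nonlinear : nonlinear_activation sigma).
Variables (d q : nat) (x : 'I_q -> 'rV[R]_d).

Local Notation reachable := (reachable sigma x).

Lemma eq_reachable k (Y Y' : 'I_q -> 'rV[R]_k) D D' :
  (forall i, Y i = Y' i) -> (forall i, D i = D' i) ->
  reachable Y D -> reachable Y' D'.
Proof. by move=> /funext -> /funext ->. Qed.

(* The values [y] and gradients [p] can be appended to every reachable family
   from which the input is still an affine read-out. *)
Definition learnable (y : 'I_q -> R) (p : 'I_q -> 'cV[R]_d) :=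
  forall k (Y : 'I_q -> 'rV[R]_k) D (P : 'M[R]_(k, d)), reachable Y D ->
    (forall i, Y i *m P = x i) -> (forall i, D i *m P = 1%:M) ->
    reachable (fun i => row_mx (Y i) (y i)%:M) (fun i => row_mx (D i) (p i)).

Lemma eq_learnable y y' p p' : (forall i, y i = y' i) -> (forall i, p i = p' i) ->
  learnable y p -> learnable y' p'.
Proof. by move=> /funext -> /funext ->. Qed.

(** Since [P] recovers the input, an affine function of the input is an affine read-out of [Y]. *)
Lemma learnable_affine (a : 'cV[R]_d) c :
  learnable (fun i => (x i *m a) 0 0 + c) (fun=> a).
Proof.
move=> k Y D P YD YP DP.
apply: (eq_reachable _ _ (reachable_affine sigma_C1 (row_mx 1%:M (P *m a))
  (row_mx 0 c%:M) YD)) => i.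
  by rewrite mul_mx_row mulmx1 add_row_mx addr0 mulmxA YP raddfD/= -mx11_scalar.
by rewrite mul_mx_row mulmx1 mulmxA DP mul1mx.
Qed.

(** A final affine map replaces two auxiliary columns by their combination. *)
Lemma reachable_combine k (Y : 'I_q -> 'rV[R]_k) D y1 p1 y2 p2 c1 c2 :
  reachable (fun i => row_mx (row_mx (Y i) (y1 i)%:M) (y2 i)%:M)
            (fun i => row_mx (row_mx (D i) (p1 i)) (p2 i : 'cV_d)) ->
  reachable (fun i => row_mx (Y i) (c1 * y1 i + c2 * y2 i)%:M)
            (fun i => row_mx (D i) (c1 *: p1 i + c2 *: p2 i : 'cV_d)).
Proof.
move=> H; pose V : 'M[R]_(k + 1 + 1, k + 1) :=
  col_mx (block_mx 1%:M 0 0 c1%:M) (row_mx 0 c2%:M).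
apply: (eq_reachable _ _ (reachable_affine sigma_C1 V 0 H)) => i; rewrite /V.
  rewrite mul_row_col mul_row_block mul_mx_row !mulmx0 add_row_mx mulmx1 !addr0 add0r.
  by rewrite -!scalar_mxM -raddfD/= (mulrC c1) (mulrC c2).
rewrite mul_row_col mul_row_block mul_mx_row !mulmx0 add_row_mx mulmx1 !addr0 add0r.
by rewrite !mul_mx_scalar.
Qed.

(** [y1] is appended first, then [y2]; extended by a zero row, [P] still recovers the input in
    between. *)
Lemma learnable_lin y1 p1 y2 p2 c1 c2 : learnable y1 p1 -> learnable y2 p2 ->
  learnable (fun i => c1 * y1 i + c2 * y2 i) (fun i => c1 *: p1 i + c2 *: p2 i).
Proof.
move=> H1 H2 k Y D P YD YP DP; apply: reachable_combine.
apply: (H2 _ _ _ (col_mx P 0) (H1 _ _ _ _ YD YP DP)) => i.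
  by rewrite mul_row_col mulmx0 addr0.
by rewrite mul_row_col mulmx0 addr0.
Qed.

Lemma learnable_sqr y p : learnable y p ->
  learnable (fun i => y i ^+ 2) (fun i => (2 * y i) *: p i).
Proof.
move=> H k Y D P YD YP DP.
have H1 := reachable_sqr sigma_C1 sigma_nonlinear (col_mx 0 1%:M) (H _ _ _ _ YD YP DP).
have E i : (row_mx (Y i) (y i)%:M *m col_mx 0 (1%:M : 'M[R]_1)) 0 0 = y i.
  by rewrite mul_row_col mulmx0 add0r mulmx1 mxE eqxx.
have H2 : reachable (fun i => row_mx (row_mx (Y i) (y i)%:M) (y i ^+ 2)%:M)
    (fun i => row_mx (row_mx (D i) (p i)) ((2 * y i) *: p i)).
  apply: (eq_reachable _ _ H1) => i; rewrite E//.
  by rewrite mul_row_col mulmx0 add0r mulmx1.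
(* The coefficients 0 and 1 drop the auxiliary [y] and keep its square. *)
apply: (eq_reachable _ _ (reachable_combine 0 1 H2)) => i.
  by rewrite mul0r add0r mul1r.
by rewrite scale0r add0r scale1r.
Qed.

(** Polarisation: a product is a quarter of the square of the sum minus the square of the
    difference. *)
Lemma learnableM y1 p1 y2 p2 : learnable y1 p1 -> learnable y2 p2 ->
  learnable (fun i => y1 i * y2 i) (fun i => y2 i *: p1 i + y1 i *: p2 i).
Proof.
move=> H1 H2.
have S1 := learnable_sqr (learnable_lin 1 1 H1 H2).
have S2 := learnable_sqr (learnable_lin 1 (-1) H1 H2).
apply: (eq_learnable _ _ (learnable_lin (4^-1) (- 4^-1) S1 S2)) => i; first by field.
by apply/matrixP => j l; rewrite !mxE; field.
Qed.

(** A product with one factor per point [z] of [L], a polynomial in a coordinate that separates [p]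
    from [z]. Each factor has zero gradient at [p] and at its own [z], so by the product rule value
    1 and gradient 0 persist at [p], and the product vanishes to first order on [L]. *)
Lemma learnable_bump (p : 'rV[R]_d) (L : seq 'rV[R]_d) : p \notin L ->
  exists (h : 'rV[R]_d -> R) (h' : 'rV[R]_d -> 'cV[R]_d),
    [/\ learnable (fun i => h (x i)) (fun i => h' (x i)), h p = 1, h' p = 0 &
     forall z, z \in L -> h z = 0 /\ h' z = 0].
Proof.
elim: L => [_|z L IH].
  exists (fun=> 1), (fun=> 0); split => //.
  apply: (eq_learnable _ _ (learnable_affine 0 1)) => // i.
  by rewrite mulmx0 mxE add0r.
rewrite inE negb_or => /andP[pz /IH[h [h' [Lh hp h'p hL]]]].
have [l pzl] : exists l, p 0 l - z 0 l != 0.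
  apply: contrapT => H; move/eqP: pz => pz; apply: pz; apply/rowP => l.
  apply/eqP; rewrite -subr_eq0; apply/negPn/negP => ?; apply: H.
  by exists l.
pose a : 'cV[R]_d := (p 0 l - z 0 l)^-1 *: delta_mx l 0.
pose u (y : 'rV[R]_d) := (y *m a) 0 0 + - (z 0 l / (p 0 l - z 0 l)).
have uE y : u y = (y 0 l - z 0 l) / (p 0 l - z 0 l).
  by rewrite /u /a -scalemxAr -colE !mxE; field.
have Lu : learnable (fun i => u (x i)) (fun=> a) by exact: learnable_affine.
have L2 := learnable_sqr Lu; have L4 := learnable_sqr L2.
(* [2 u ^ 2 - u ^ 4] is 1 where u = 1 and 0 where u = 0, and critical there. *)
have Lb := learnableM Lh (learnable_lin 2 (-1) L2 L4).
have up : u p = 1 by rewrite uE divff.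
have uz : u z = 0 by rewrite uE subrr mul0r.
pose b y := 2 * u y ^+ 2 + -1 * (u y ^+ 2) ^+ 2.
exists (fun y => h y * b y), (fun y => b y *: h' y + h y *:
  (2 *: ((2 * u y) *: a) + -1 *: ((2 * u y ^+ 2) *: ((2 * u y) *: a)))).
rewrite /b; split; first exact: Lb.
- by rewrite hp up; ring.
- rewrite h'p hp up scaler0 add0r scale1r.
  by apply/matrixP => i j; rewrite !mxE; ring.
- move=> y; rewrite inE => /predU1P[->|/hL[-> ->]].
    rewrite uz; split; first by ring.
    by apply/matrixP => i j; rewrite !mxE; ring.
  by rewrite mul0r scaler0 scale0r addr0.
Qed.

(** Points are added one at a time. The correction for [p] is the bump times an affine function
    carrying the missing value and gradient at [p]; it vanishes to first order on the earlier
    points. *)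
Lemma learnable_interpolation (f : 'rV[R]_d -> R) (f' : 'rV[R]_d -> 'cV[R]_d) L :
  uniq L -> exists (h : 'rV[R]_d -> R) (h' : 'rV[R]_d -> 'cV[R]_d),
    learnable (fun i => h (x i)) (fun i => h' (x i)) /\
    forall p, p \in L -> h p = f p /\ h' p = f' p.
Proof.
elim: L => [_|p L IH /= /andP[pL /IH[h [h' [Lh hL]]]]].
  exists (fun=> 0), (fun=> 0); split => //.
  apply: (eq_learnable _ _ (learnable_affine 0 0)) => // i.
  by rewrite mulmx0 mxE add0r.
have [e [e' [Le ep e'p eL]]] := learnable_bump pL.
pose v := f' p - h' p.
have Lv := learnable_affine v (f p - h p - (p *m v) 0 0).
have Lc := learnable_lin 1 1 Lh (learnableM Le Lv).
eexists (fun y => 1 * h y + 1 * (e y * ((y *m v) 0 0 + (f p - h p - (p *m v) 0 0)))),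
  (fun y => 1 *: h' y + 1 *: (((y *m v) 0 0 + (f p - h p - (p *m v) 0 0)) *: e' y + e y *: v)).
split; first exact: Lc.
move=> y; rewrite inE => /predU1P[->|yL].
  rewrite ep e'p !scale1r scaler0 add0r; split; first by ring.
  by rewrite /v addrC subrK.
have [-> ->] := eL _ yL; have [<- <-] := hL _ yL.
by rewrite mul0r mulr0 addr0 mul1r scale0r scaler0 !addr0 scaler0 addr0 scale1r.
Qed.

(** [undup] merges repeated samples, whose data agree because they are functions of the point. *)
Lemma learnable_all (f : 'rV[R]_d -> R) (f' : 'rV[R]_d -> 'cV[R]_d) :
  learnable (fun i => f (x i)) (fun i => f' (x i)).
Proof.
have [h [h' [Lh hL]]] := learnable_interpolation f f' (undup_uniq (codom x)).
have xL i : x i \in undup (codom x) by rewrite mem_undup codom_f.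
by apply: eq_learnable Lh => i; have [] := hL _ (xL i).
Qed.

(** Next to a copy of the input, the components of [F] are learned in turn and added to a running
    sum; at the end the copy is dropped. *)
Lemma reachable_all N (F : 'rV[R]_d -> 'rV[R]_N) (F' : 'rV[R]_d -> 'M[R]_(d, N)) :
  reachable (fun i => F (x i)) (fun i => F' (x i)).
Proof.
suff H (s : seq 'I_N) : reachable
    (fun i => row_mx (x i) (\sum_(l <- s) F (x i) 0 l *: delta_mx 0 l))
    (fun i => row_mx 1%:M (\sum_(l <- s) col l (F' (x i)) *m delta_mx 0 l)).
  apply: (eq_reachable _ _ (reachable_affine sigma_C1 (col_mx 0 1%:M) 0 (H (index_enum _)))) => i.
    by rewrite mul_row_col mulmx0 mulmx1 add0r addr0 -row_sum_delta.
  by rewrite mul_row_col mulmx0 mulmx1 add0r -col_sum_delta.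
elim: s => [|l s IH].
  apply: (eq_reachable _ _ (reachable_affine sigma_C1 (row_mx 1%:M 0) 0
    (reachable_input _ _))) => i.
    by rewrite mul_mx_row mulmx0 mulmx1 addr0 big_nil.
  by rewrite mul_mx_row mulmx0 mulmx1 big_nil.
have H := @learnable_all (fun z => F z 0 l) (fun z => col l (F' z)) _ _ _ (col_mx 1%:M 0) IH.
have {}H := H (fun i => _) (fun i => _).
apply: (eq_reachable _ _ (reachable_affine sigma_C1
  (col_mx 1%:M (row_mx 0 (delta_mx 0 l))) 0 (H _ _))) => i.
- rewrite mul_row_col mulmx1 mul_mx_row mulmx0 add_row_mx !addr0.
  by rewrite big_cons mul_scalar_mx addrC.
- by rewrite mul_row_col mulmx1 mul_mx_row mulmx0 add_row_mx addr0 big_cons addrC.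
- by rewrite mul_row_col mulmx1 mulmx0 addr0.
- by rewrite mul_row_col mulmx1 mulmx0 addr0.
Qed.

End learnable.

(** * Perturbation of the gradient *)

Section norms.
Variable R : realType.

Lemma is_norm0 (V : lmodType R) (nu : V -> R) : is_norm nu -> nu 0 = 0.
Proof. by move=> [_ h _]; rewrite -(scale0r (0 : V)) h normr0 mul0r. Qed.

Lemma is_normN (V : lmodType R) (nu : V -> R) v : is_norm nu -> nu (- v) = nu v.
Proof. by move=> [_ h _]; rewrite -scaleN1r h normrN1 mul1r. Qed.

(** It follows from [0 = nu (v - v) <= 2 * nu v]. *)
Lemma is_norm_ge0 (V : lmodType R) (nu : V -> R) v : is_norm nu -> 0 <= nu v.
Proof.
move=> nuP; have [tri _ _] := nuP.
by have := tri v (- v); rewrite subrr is_norm0// is_normN// -mulr2n pmulrn_lge0.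
Qed.

Lemma is_norm_sum (V : lmodType R) (nu : V -> R) I (s : seq I) (F : I -> V) :
  is_norm nu -> nu (\sum_(i <- s) F i) <= \sum_(i <- s) nu (F i).
Proof.
move=> nuP; elim: s => [|i s IH]; first by rewrite !big_nil is_norm0.
have [tri _ _] := nuP.
by rewrite !big_cons (le_trans (tri _ _))// lerD2l.
Qed.

(** Expansion on the matrix units; the [+ 1] keeps the constant positive even for empty matrices. *)
Lemma is_norm_le_mx m n (nu : 'M[R]_(m, n) -> R) : is_norm nu ->
  exists2 C, 0 < C & forall A, nu A <= C * `|A|.
Proof.
move=> nuP; have [_ hom _] := nuP.
have S0 : 0 <= \sum_i \sum_j nu (delta_mx i j : 'M[R]_(m, n)).
  by apply: sumr_ge0 => i _; apply: sumr_ge0 => j _; exact: is_norm_ge0.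
exists (\sum_i \sum_j nu (delta_mx i j : 'M[R]_(m, n)) + 1) => [|A].
  by rewrite ltr_wpDl.
rewrite mulrDl mul1r [X in nu X]matrix_sum_delta.
apply: (@le_trans _ _ ((\sum_i \sum_j nu (delta_mx i j : 'M[R]_(m, n))) * `|A|)); last first.
  by rewrite lerDl.
apply: (le_trans (is_norm_sum _ _ nuP)); rewrite mulr_suml; apply: ler_sum => i _.
apply: (le_trans (is_norm_sum _ _ nuP)); rewrite mulr_suml; apply: ler_sum => j _.
by rewrite hom mulrC ler_wpM2l ?is_norm_ge0// ler_normmx.
Qed.

Lemma is_norm_continuous n (nu : 'rV[R]_n -> R) : is_norm nu -> continuous nu.
Proof.
move=> nuP; have [C C0 HC] := is_norm_le_mx nuP; have [tri _ _] := nuP.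
have lip u v : nu u - nu v <= C * `|u - v|.
  by rewrite lerBlDr -{1}(subrK v u) (le_trans (tri _ _))// lerD2r.
move=> u; apply/(@cvgrPdist_le _ _ _ (nbhs u) (nbhs_filter u) nu) => e e0.
have eC : 0 < e / C by rewrite divr_gt0.
have ub : nbhs u (ball u (e / C)) := nbhsx_ballx u _ eC.
apply: (filterS _ ub) => v; rewrite -ball_normE/= => uv.
have {}uv : C * `|u - v| <= e by rewrite mulrC -ler_pdivlMr// ltW.
by rewrite ler_norml lerNl opprB !(le_trans (lip _ _))// distrC.
Qed.

(** By continuity [nu] attains a minimum on the compact unit sphere, positive because [nu] separates
    points; homogeneity extends the bound to all vectors. *)
Lemma rV_le_is_norm n (nu : 'rV[R]_n -> R) : is_norm nu ->
  exists2 C, 0 < C & forall v, `|v| <= C * nu v.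
Proof.
move=> nuP; have [_ hom sep] := nuP.
pose S : set 'rV[R]_n := [set v | `|v| = 1].
have normalize v : v != 0 -> S (`|v|^-1 *: v).
  move=> v0; rewrite /S/= normrZ normfV normr_id mulVf//.
  by rewrite normr_eq0.
have cS : compact S.
  apply: bounded_closed_compact.
    by exists 1; split => // M M1 v /= ->; exact: ltW.
  have -> : S = (fun v => `|v|) @^-1` [set 1] by [].
  apply: closed_comp; last exact: closed_eq.
  by move=> v _; exact: norm_continuous.
(* The sphere is empty when [n = 0], and 0 is then the only vector. *)
have [S0|/set0P/negP/negPn/eqP S0] := pselect (S !=set0); last first.
  exists 1 => // v; have [->|/normalize] := eqVneq v 0.
    by rewrite normr0 mul1r is_norm0.
  by rewrite S0.
have [c cS' Hc] := EVT_min_rV S0 cS (continuous_subspaceT (is_norm_continuous nuP)).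
rewrite inE in cS'.
have c0 : 0 < nu c.
  rewrite lt_def is_norm_ge0// andbT; apply/eqP => /sep c0.
  by move: cS'; rewrite /S/= c0 normr0 => /esym/eqP; rewrite oner_eq0.
exists (nu c)^-1 => [|v]; first by rewrite invr_gt0.
have [->|v0] := eqVneq v 0; first by rewrite normr0 is_norm0// mulr0.
have /mem_set/Hc := normalize _ v0; rewrite hom normfV normr_id.
by rewrite ler_pdivlMl ?normr_gt0// ler_pdivlMl// mulrC.
Qed.

Lemma mx_le_is_norm m n (nu : 'M[R]_(m, n) -> R) : is_norm nu ->
  exists2 C, 0 < C & forall A, `|A| <= C * nu A.
Proof.
move=> [tri hom sep].
have [|C C0 HC] := @rV_le_is_norm _ (nu \o vec_mx).
  split => [u v|a v|v /= /sep/(congr1 mxvec)] /=.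
  - by rewrite raddfD/= tri.
  - by rewrite linearZ/= hom.
  - by rewrite vec_mxK raddf0.
exists C => // A; have := HC (mxvec A); rewrite /= mxvecK; apply: le_trans.
by apply/normmx_le => // i j; rewrite -(mxvecE A) ler_normmx.
Qed.

End norms.

(** * Chain rule for gradients and replacement of a layer on one sample *)

Section gradients.
Variable R : realType.

Lemma row_mx_subl k n m (A B : 'M[R]_(k, n)) (C : 'M[R]_(k, m)) :
  row_mx A C - row_mx B C = row_mx (A - B) 0.
Proof. by rewrite opp_row_mx add_row_mx subrr. Qed.

Lemma differentiable_row_mx (V : normedModType R) n m (f : V -> 'rV[R]_n)
    (g : V -> 'rV[R]_m) a :
  differentiable f a -> differentiable g a ->
  differentiable (fun v => row_mx (f v) (g v)) a.
Proof.
move=> df dg; apply: differentiable_rV => j.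
under eq_fun do rewrite mxE.
by case: fintype.split => k; exact: differentiable_coord_comp.
Qed.

Lemma jacobian_row_mx p n m (f : 'rV[R]_p -> 'rV[R]_n) (g : 'rV[R]_p -> 'rV[R]_m) a :
  differentiable f a -> differentiable g a ->
  jacobian (fun v => row_mx (f v) (g v)) a = row_mx (jacobian f a) (jacobian g a).
Proof.
move=> df dg; have dfg := differentiable_row_mx df dg.
apply/row_matrixP => i; rewrite !rowE mul_mx_row; apply/rowP => j.
rewrite -derive_coord// [RHS]mxE.
under eq_fun do rewrite mxE.
by case: fintype.split => k; rewrite derive_coord.
Qed.

Lemma diff_gradient n (f : 'rV[R]_n -> R) a v : differentiable f a ->
  'd f a v = (gradient f a *m v^T) 0 0.
Proof.
move=> df; rewrite [v in LHS]row_sum_delta raddf_sum/= mxE; apply: eq_bigr => j _.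
by rewrite linearZ/= !mxE deriveE// mulrC.
Qed.

(** One step of back-propagation: the row [gradient h] is pulled back by the transpose of the
    Jacobian. *)
Lemma gradient_comp p n (f : 'rV[R]_p -> 'rV[R]_n) (h : 'rV[R]_n -> R) a :
  differentiable f a -> differentiable h (f a) ->
  gradient (fun v => h (f v)) a = gradient h (f a) *m (jacobian f a)^T.
Proof.
move=> df dh; apply/rowP => j.
rewrite mxE deriveE; last exact: (differentiable_comp df dh).
rewrite (diff_comp df dh)/= diff_gradient// -deriveE// deriveEjacobian// -rowE.
by rewrite tr_row !mxE; apply: eq_bigr => k _; rewrite !mxE.
Qed.

Lemma gradient_mean p n (f : 'I_n -> 'rV[R]_p -> R) (c : R) a :
  (forall i, differentiable (f i) a) ->
  gradient (fun v => c * \sum_i f i v) a = c *: \sum_i gradient (f i) a.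
Proof.
move=> df; apply/rowP => j; rewrite !mxE summxE.
have dS i : derivable (f i) a (delta_mx 0 j) by exact: diff_derivable.
have -> : (fun v => c * \sum_i f i v) = c \*: (\sum_i f i).
  by apply/funext => v /=; rewrite fct_sumE.
rewrite deriveZ; last exact: derivable_sum.
by rewrite derive_sum//; congr (_ * _); apply: eq_bigr => i _; rewrite mxE.
Qed.

Section sample.
Variables (p d N m : nat) (up : 'rV[R]_p -> 'rV[R]_d) (byp : 'rV[R]_p -> 'rV[R]_m)
          (H : 'rV[R]_(N + m) -> R) (w : 'rV[R]_p).
Hypotheses (dup : differentiable up w) (dbyp : differentiable byp w).

Definition sample_loss (Q : 'rV[R]_d -> 'rV[R]_N) (v : 'rV[R]_p) : R :=
  H (row_mx (Q (up v)) (byp v)).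

(** Jacobian at [w] of the argument of the head, as a function of the Jacobian [J] of the layer to
    be replaced. *)
Definition sample_jacobian (J : 'M[R]_(d, N)) : 'M[R]_(p, N + m) :=
  row_mx (jacobian up w *m J) (jacobian byp w).

Lemma differentiable_sample_loss Q : differentiable Q (up w) ->
  differentiable H (row_mx (Q (up w)) (byp w)) ->
  differentiable (sample_loss Q) w.
Proof.
move=> dQ dH.
have dg : differentiable (fun v => row_mx (Q (up v)) (byp v)) w.
  exact: (differentiable_row_mx (differentiable_comp dup dQ) dbyp).
exact: (differentiable_comp dg dH).
Qed.

Lemma gradient_sample_loss Q : differentiable Q (up w) ->
  differentiable H (row_mx (Q (up w)) (byp w)) ->
  gradient (sample_loss Q) w = gradient H (row_mx (Q (up w)) (byp w)) *m
    (sample_jacobian (jacobian Q (up w)))^T.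
Proof.
move=> dQ dH.
have dQu : differentiable (fun v => Q (up v)) w := differentiable_comp dup dQ.
have dg := differentiable_row_mx dQu dbyp.
rewrite (@gradient_comp _ _ (fun v => row_mx (Q (up v)) (byp v)) H)//.
by rewrite jacobian_row_mx// (@jacobian_comp _ _ _ _ up).
Qed.

(** The gradient is a product of the head gradient and a Jacobian. Its variation splits into that of
    the head gradient, controlled by the Lipschitz bound, and that of the Jacobian, linear in the
    variation of [J]. *)
Lemma sample_gradient_perturbation Q : differentiable Q (up w) ->
  C11_at H (row_mx (Q (up w)) (byp w)) ->
  exists C delta : R, [/\ 0 < C, 0 < delta & forall e Q2, e <= delta ->
    differentiable Q2 (up w) -> `|Q2 (up w) - Q (up w)| <= e ->
    `|jacobian Q2 (up w) - jacobian Q (up w)| <= e ->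
    differentiable (sample_loss Q2) w /\
    `|gradient (sample_loss Q2) w - gradient (sample_loss Q) w| <= C * e].
Proof.
move=> dQ [V [Vv dHV lipV]].
set v := row_mx _ _ in Vv; set x := up w in dQ v Vv *.
have [L L0 HL] : exists2 L : R, 0 < L & forall v1 v2, V v1 -> V v2 ->
    `|gradient H v1 - gradient H v2| <= L * `|v1 - v2|.
  have [L L0 HL] := pinfty_ex_gt0 lipV.
  by exists L => // v1 v2 V1 V2; exact: (HL (v1, v2)).
have /nbhs_ballP[rho /= rho0 Hrho] := Vv.
(* [K] bounds the perturbed Jacobian, since [e <= 1] keeps the one of [Q2] within 1 of that of [Q];
   [B] is the factor of [e] in the second term. *)
pose K := d%:R * (`|jacobian up w| * (`|jacobian Q x| + 1)) + `|jacobian byp w|.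
have K0 : 0 <= K by rewrite !(addr_ge0, mulr_ge0).
pose B := `|gradient H v| * (d%:R * `|jacobian up w|).
have B0 : 0 <= B by rewrite !mulr_ge0.
have NB : 0 <= (N + m)%:R * (L * K + B) :> R by rewrite mulr_ge0// addr_ge0// mulr_ge0// ltW.
(* The [+ 1] makes the constant positive; [rho / 2] keeps the perturbed argument of the head inside
   the ball where its gradient is Lipschitz. *)
exists ((N + m)%:R * (L * K + B) + 1), (Num.min 1 (rho / 2)); split.
- by rewrite ltr_wpDl.
- by rewrite lt_min ltr01 divr_gt0.
move=> e Q2; rewrite le_min => /andP[e1 erho] dQ2 Q2e J2e.
have e0 : 0 <= e := le_trans (normr_ge0 _) Q2e.
set v2 := row_mx (Q2 x) (byp w).
have v2e : `|v2 - v| <= e.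
  rewrite /v2 /v row_mx_subl (le_trans (normmx_row_mx _ _))//.
  by rewrite normr0 addr0.
have V2 : V v2.
  apply: Hrho; rewrite -ball_normE/= distrC (le_lt_trans v2e)// (le_lt_trans erho)//.
  by rewrite ltr_pdivrMr// ltr_pMr// ltr1n.
have V1 : V v := nbhs_singleton Vv.
split; first by apply: differentiable_sample_loss => //; exact: dHV.
pose A2 := sample_jacobian (jacobian Q2 x); pose A := sample_jacobian (jacobian Q x).
have -> : gradient (sample_loss Q2) w = gradient H v2 *m A2^T.
  by apply: gradient_sample_loss => //; exact: dHV.
have -> : gradient (sample_loss Q) w = gradient H v *m A^T.
  by apply: gradient_sample_loss => //; exact: dHV.
have -> : gradient H v2 *m A2^T - gradient H v *m A^T =
    (gradient H v2 - gradient H v) *m A2^T + gradient H v *m (A2 - A)^T.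
  by rewrite mulmxBl raddfB/= mulmxBr addrA subrK.
have A2K : `|A2^T| <= K.
  rewrite (le_trans (normmx_trmx _))// (le_trans (normmx_row_mx _ _))// lerD2r.
  rewrite (le_trans (normmx_mulmx _ _))// !ler_wpM2l//.
  rewrite -(subrK (jacobian Q x) (jacobian Q2 x)) addrC.
  by rewrite (le_trans (ler_normD _ _))// lerD2l (le_trans J2e).
have A2A : A2 - A = row_mx (jacobian up w *m (jacobian Q2 x - jacobian Q x)) 0.
  by rewrite mulmxBr; exact: row_mx_subl.
have AA : `|(A2 - A)^T| <= d%:R * `|jacobian up w| * e.
  apply: (le_trans (normmx_trmx _)); rewrite A2A.
  apply: (le_trans (normmx_row_mx _ _)); rewrite normr0 addr0.
  apply: (le_trans (normmx_mulmx _ _)); rewrite mulrA.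
  by rewrite ler_wpM2l// mulr_ge0.
rewrite (le_trans (ler_normD _ _))// mulrDl mul1r.
apply: (@le_trans _ _ ((N + m)%:R * (L * K + B) * e)); last by rewrite lerDl.
rewrite -mulrA [(L * K + B) * e]mulrDl mulrDr lerD// (le_trans (normmx_mulmx _ _))//.
  rewrite ler_wpM2l// mulrAC ler_pM// (le_trans (HL _ _ V2 V1))//.
  by rewrite ler_pM2l.
by rewrite ler_wpM2l// /B -!mulrA ler_wpM2l// mulrA.
Qed.

End sample.
End gradients.

(** * Batch statements in arbitrary norms *)

Lemma mlp_approximation (R : realType) (d N Nb : nat)
    (nuN : 'rV[R]_N -> R) (nuJ : 'M[R]_(d, N) -> R)
    (Q : 'rV[R]_d -> 'rV[R]_N) (x : 'I_Nb -> 'rV[R]_d) (sigma : R -> R) (e1 e2 : R) :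
  is_norm nuN -> is_norm nuJ -> C1_activation sigma -> nonlinear_activation sigma ->
  0 < e1 -> 0 < e2 ->
  exists net : mlp R N d, approx_on_batch nuN nuJ (mlp_eval sigma net) Q x e1 e2.
Proof.
move=> nuN_norm nuJ_norm sigma_C1 sigma_nl e10 e20.
have [CN CN0 HN] := is_norm_le_mx nuN_norm.
have [CJ CJ0 HJ] := is_norm_le_mx nuJ_norm.
(* An entrywise tolerance that [CN] and [CJ] turn into [e1] for [nuN] and [e2] for [nuJ]. *)
have e0 : 0 < Num.min (e1 / CN) (e2 / CJ) by rewrite lt_min !divr_gt0.
have [net Hnet] := reachable_all sigma_C1 sigma_nl x Q (jacobian Q) e0.
exists net; split; apply: bigmax_le => [|i _]; try exact: ltW.
- have [H _] := Hnet i; apply: (le_trans (HN _)).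
  by rewrite mulrC -ler_pdivlMr// (le_trans H)// ge_min lexx.
- have [_ H] := Hnet i; apply: (le_trans (HJ _)).
  by rewrite mulrC -ler_pdivlMr// (le_trans H)// ge_min lexx orbT.
Qed.

(** The per-sample bounds are averaged. The constants are fixed before the tolerances and [Q2], as
    the O-notation demands. *)
Lemma batch_gradient_perturbation (R : realType) (X : Type) (p d N m k n : nat)
    (nuN : 'rV[R]_N -> R) (nuJ : 'M[R]_(d, N) -> R) (nup : 'rV[R]_p -> R)
    (G : hybrid_graph R X p d N m k) (s : 'I_n -> X) (Q : 'rV[R]_d -> 'rV[R]_N)
    (x : 'I_n -> 'rV[R]_d) (w : 'rV[R]_p) :
  is_norm nuN -> is_norm nuJ -> is_norm nup ->
  (forall i, upstream G (s i) w = x i) -> (forall i, differentiable Q (x i)) ->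
  regular_at G s Q w ->
  exists C delta : R, [/\ 0 < C, 0 < delta &
    forall e1 e2 Q2, 0 < e1 <= delta -> 0 < e2 <= delta ->
      (forall i, differentiable Q2 (x i)) -> approx_on_batch nuN nuJ Q2 Q x e1 e2 ->
      nup (gradient (batch_loss G s Q2) w - gradient (batch_loss G s Q) w)
        <= C * Num.max e1 e2].
Proof.
move=> nuN_norm nuJ_norm nup_norm upx dQ reg.
have [CN CN0 HN] := mx_le_is_norm nuN_norm.
have [CJ CJ0 HJ] := mx_le_is_norm nuJ_norm.
have [Cp Cp0 Hp] := is_norm_le_mx nup_norm.
pose L i := sample_loss (upstream G (s i)) (bypass G (s i)) (head_loss G (s i)).
have /choice[Cd HCd] : forall i, exists Cd : R * R, [/\ 0 < Cd.1, 0 < Cd.2 &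
    forall e Q2, e <= Cd.2 -> differentiable Q2 (x i) -> `|Q2 (x i) - Q (x i)| <= e ->
    `|jacobian Q2 (x i) - jacobian Q (x i)| <= e ->
    differentiable (L i Q2) w /\
    `|gradient (L i Q2) w - gradient (L i Q) w| <= Cd.1 * e].
  move=> i; have [dup dbyp dH] := reg i.
  have dQi : differentiable Q (upstream G (s i) w) by rewrite upx.
  have [C [delta [C0 delta0 H]]] := sample_gradient_perturbation dup dbyp dQi dH.
  by exists (C, delta); rewrite -upx.
(* As [c] dominates [CN] and [CJ], the single number [c * Num.max e1 e2] bounds both errors
   entrywise. *)
pose c := CN + CJ; have c0 : 0 < c by rewrite addr_gt0.
(* The default 1 keeps the minimum positive even over an empty batch. *)
pose delta := \big[Num.min/1]_i (Cd i).2.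
have delta0 : 0 < delta.
  rewrite /delta; elim/big_ind : _ => [//|a b a0 b0|i _]; last by have [] := HCd i.
  by rewrite lt_min a0.
(* The case [Q2 = Q], [e = 0] of the sample bound. *)
have LQ i : differentiable (L i Q) w.
  have [C0 d0 H] := HCd i; apply: (H 0 Q (ltW d0) (dQ i) _ _).1.
  - by rewrite subrr normr0.
  - by rewrite subrr normr0.
have gradE Q2 : (forall i, differentiable (L i Q2) w) ->
    gradient (batch_loss G s Q2) w = n%:R^-1 *: \sum_i gradient (L i Q2) w.
  exact: gradient_mean.
pose S := n%:R^-1 * \sum_i (Cd i).1.
have S0 : 0 <= S.
  by rewrite mulr_ge0 ?invr_ge0// sumr_ge0// => i _; have [/ltW] := HCd i.
exists (Cp * S * c + 1), (delta / c); split.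
- by rewrite ltr_wpDl// mulr_ge0 ?(ltW c0)// mulr_ge0 ?(ltW Cp0).
- by rewrite divr_gt0.
move=> e1 e2 Q2 /andP[e10 e1d] /andP[e20 e2d] dQ2 [A1 A2].
pose e := c * Num.max e1 e2.
have ed i : e <= (Cd i).2.
  rewrite /e mulrC -ler_pdivlMr// (@le_trans _ _ (delta / c)) ?ge_max ?e1d//.
  by rewrite ler_pM2r ?invr_gt0//; exact: bigmin_le.
have m0 : 0 <= Num.max e1 e2 by rewrite le_max ltW.
have Q2e i : `|Q2 (x i) - Q (x i)| <= e.
  apply: (le_trans (HN _)); rewrite /e; apply: ler_pM.
  - exact: ltW.
  - exact: is_norm_ge0.
  - by rewrite lerDl ltW.
  - by rewrite le_max (le_trans (le_bigmax _ _ i) A1).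
have J2e i : `|jacobian Q2 (x i) - jacobian Q (x i)| <= e.
  apply: (le_trans (HJ _)); rewrite /e; apply: ler_pM.
  - exact: ltW.
  - exact: is_norm_ge0.
  - by rewrite lerDr ltW.
  - by rewrite le_max (le_trans (le_bigmax _ _ i) A2) orbT.
have LQ2 i : differentiable (L i Q2) w.
  by have [_ _ H] := HCd i; have [] := H e Q2 (ed i) (dQ2 i) (Q2e i) (J2e i).
rewrite gradE// (gradE Q)// -scalerBr -sumrB.
apply: (le_trans (Hp _)); rewrite mulrDl mul1r.
apply: (@le_trans _ _ (Cp * S * c * Num.max e1 e2)); last by rewrite lerDl.
rewrite -!mulrA ler_pM2l// normrZ ger0_norm ?invr_ge0// ler_wpM2l ?invr_ge0//.
rewrite (le_trans (ler_norm_sum _ _ _))// mulr_suml; apply: ler_sum => i _.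
by have [_ _ H] := HCd i; have [] := H e Q2 (ed i) (dQ2 i) (Q2e i) (J2e i).
Qed.

Theorem theorem1 (R : realType) (d N Nb : nat)
    (nud : 'rV[R]_d -> R) (nuN : 'rV[R]_N -> R) (nuJ : 'M[R]_(d, N) -> R)
    (nud_norm : is_norm nud) (nuN_norm : is_norm nuN) (nuJ_norm : is_norm nuJ)
    (Q : 'rV[R]_d -> 'rV[R]_N) (Q_cube : forall x, in_unit_cube (Q x))
    (U : set 'rV[R]_d) (U_open : open U) (Q_C1 : C1_on Q U)
    (Nb_gt0 : (0 < Nb)%N) (x : 'I_Nb -> 'rV[R]_d) (xU : forall i, U (x i))
    (r : R) (x_ball : forall i, nud (x i - mean x) <= r)
    (sigma : R -> R) (sigma_C1 : C1_activation sigma)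
    (sigma_nonlinear : nonlinear_activation sigma) :
  (forall e1 e2 : R, 0 < e1 -> 0 < e2 ->
     exists net : mlp R N d,
       approx_on_batch nuN nuJ (mlp_eval sigma net) Q x e1 e2)
  /\
  (forall (X : Type) (p m k : nat) (G : hybrid_graph R X p d N m k)
      (s : 'I_Nb -> X) (w : 'rV[R]_p) (nup : 'rV[R]_p -> R),
     is_norm nup ->
     (forall i, upstream G (s i) w = x i) ->
     regular_at G s Q w ->
     exists C delta : R, [/\ 0 < C, 0 < delta &
       forall (e1 e2 : R) (net : mlp R N d),
         0 < e1 <= delta -> 0 < e2 <= delta ->
         approx_on_batch nuN nuJ (mlp_eval sigma net) Q x e1 e2 ->
         nup (gradient (batch_loss G s (mlp_eval sigma net)) w
              - gradient (batch_loss G s Q) w)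
           <= C * Num.max e1 e2]).
Proof.
split=> [e1 e2 e10 e20|X p m k G s w nup nup_norm upx reg].
  exact: mlp_approximation.
have dQ i : differentiable Q (x i) by have [] := Q_C1 _ (xU i).
have [C [delta [C0 delta0 H]]] :=
  batch_gradient_perturbation nuN_norm nuJ_norm nup_norm upx dQ reg.
exists C, delta; split => // e1 e2 net he1 he2.
by apply: H => // i; apply: differentiable_mlp_eval; exact: sigma_C1.1.
Qed.
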